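(* In the model described in the context, let $f:\mathcal X\times[K]\to\mathbb R$ be a measurable predictor and $\hat Y=f(\mathbf X,S)$. Then the following are equivalent. (i) (Counterfactual fairness) For all $s\in[K]$, for $P_{\mathbf X\mid S=s}$-almost every $\mathbf x$, and for all $s'\in[K]$, $$(\hat Y_{S\leftarrow s}\mid \mathbf X=\mathbf x,S=s)\overset{d}{=}(\hat Y_{S\leftarrow s'}\mid \mathbf X=\mathbf x,S=s).$$ (ii) (Demographic parity conditional on $V$) For $P_V$-almost every $v$ and all $s,s'\in[K]$, $$(f(\mathbf X,S)\mid V=v,S=s)\overset{d}{=}(f(\mathbf X,S)\mid V=v,S=s').$$
   Context: Model: $(\mathbf X,V,S)$ takes values in $\mathcal X\times[0,1]\times[K]$, where $\mathcal X\subseteq\mathbb R^d$ is measurable and $[K]=\{1,\dots,K\}$. $S$ is the sensitive attribute with $w_s=\mathbb P(S=s)>0$ for all $s$. The exogenous variable $V$ is uniform on $[0,1]$ and independent of $S$. The features are generated by $\mathbf X=\phi(V,S,\varepsilon_{\mathbf X})$ with $\phi$ measurable and $\varepsilon_{\mathbf X}$ an exogenous noise that is independent of $S$ conditionally on $V$. There is a measurable map $\psi$ such that $V=\psi(\mathbf X,S)$ almost surely. Counterfactuals with re-sampled noise: given $(\mathbf X=\mathbf x,S=s)$ and $s'\in[K]$, set $v=\psi(\mathbf x,s)$, draw $\mathbf X'\sim\mathrm{Law}(\mathbf X\mid V=v,S=s')$ (equivalently $\mathbf X'=\phi(v,s',\varepsilon'_{\mathbf X})$ with $\varepsilon'_{\mathbf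 X}$ a fresh draw from the conditional law of $\varepsilon_{\mathbf X}$ given $V=v$), and output $\hat Y_{S\leftarrow s'}:=f(\mathbf X',s')$. The law of $(\hat Y_{S\leftarrow s'}\mid\mathbf X=\mathbf x,S=s)$ is the law of this output. This applies also when $s'=s$. $\overset{d}{=}$ denotes equality in distribution. *)

(* Defs.v *)
(* MathComp-Analysis *)
From HB Require Import structures.
From mathcomp Require Import all_boot all_order all_algebra.
From mathcomp Require Import all_classical all_reals all_analysis.

Set Implicit Arguments.
Unset Strict Implicit.
Unset Printing Implicit Defensive.
Import Order.TTheory GRing.Theory Num.Theory.

Local Open Scope classical_set_scope.
Local Open Scope ring_scope.

(* 'I_n.+1 carries the discrete sigma-algebra. A set [K] that supports a random
   variable is nonempty, so it is represented by 'I_K.+1, with K.+1 groups. *)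
HB.instance Definition _ (n : nat) := isPointed.Build 'I_n.+1 ord0.
HB.instance Definition _ (n : nat) := @isMeasurable.Build
  default_measure_display 'I_n.+1 discrete_measurable discrete_measurable0
  discrete_measurableC discrete_measurableU.

Section subspace.
Context d (T : measurableType d) (A : set T).

(* measurableType requires a point; x0 plays no other role *)
Definition pointed_sub (x0 : A) : Type := A.
HB.instance Definition _ (x0 : A) := Choice.on (pointed_sub x0).
HB.instance Definition _ (x0 : A) := isPointed.Build (pointed_sub x0) x0.

Definition sub_incl (x0 : A) : pointed_sub x0 -> T := val.

(* A with its trace sigma-algebra *)
Definition msubspace (x0 : A) : measurableType (preimage_display (@sub_incl x0)) :=
  g_sigma_algebra_preimageType (@sub_incl x0).

End subspace.

Section unit_interval.
Variable R : realType.

Lemma unit_interval0 : (0 : R) \in `[0, 1]%classic.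
Proof. by rewrite inE/= in_itv/= lexx ler01. Qed.

Definition unit_interval :=
  @msubspace _ R `[0, 1]%classic (exist _ (0 : R) unit_interval0).

Definition unit_val : unit_interval -> R := @sub_incl _ _ _ _.

End unit_interval.

Section conditioning.
Context d (Om : measurableType d) (R : realType) (P : probability Om R).

Local Open Scope ereal_scope.

Definition independent_RV d1 d2 (T1 : measurableType d1)
    (T2 : measurableType d2) (Y : Om -> T1) (Z : Om -> T2) : Prop :=
  forall A B, measurable A -> measurable B ->
    P (Y @^-1` A `&` Z @^-1` B) = P (Y @^-1` A) * P (Z @^-1` B).

(* g (Z w) is a version of the conditional probability P(E | Z) *)
Definition is_cond_probability d2 (T2 : measurableType d2) (Z : Om -> T2)
    (E : set Om) (g : T2 -> R) : Prop :=
  measurable_fun [set: T2] g /\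
  forall A, measurable A ->
    P (Z @^-1` A `&` E) = \int[P]_(w in Z @^-1` A) (g (Z w))%:E.

(* P(Y1 \in A, Y2 \in B | Z) = P(Y1 \in A | Z) P(Y2 \in B | Z) almost surely *)
Definition cond_independent_RV d1 d2 d3 (T1 : measurableType d1)
    (T2 : measurableType d2) (T3 : measurableType d3)
    (Y1 : Om -> T1) (Y2 : Om -> T2) (Z : Om -> T3) : Prop :=
  forall A B, measurable A -> measurable B ->
    exists g h : T3 -> R,
      [/\ is_cond_probability Z (Y1 @^-1` A) g,
          is_cond_probability Z (Y2 @^-1` B) h &
          is_cond_probability Z (Y1 @^-1` A `&` Y2 @^-1` B)
            (fun z => (g z * h z)%R)].

(* k z is a (regular) version of Law(Y | Z = z) *)
Definition is_cond_law d1 d2 (T1 : measurableType d1) (T2 : measurableType d2)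
    (Y : Om -> T1) (Z : Om -> T2) (k : R.-pker T2 ~> T1) : Prop :=
  forall A B, measurable A -> measurable B ->
    P (Z @^-1` A `&` Y @^-1` B) = \int[P]_(w in Z @^-1` A) k (Z w) B.

Lemma measurable_event_eq n (S : {RV P >-> 'I_n.+1}) (s : 'I_n.+1) :
  measurable (S @^-1` [set s]).
Proof. exact: measurable_funPTI. Qed.

(* P( . | S = s), when P(S = s) > 0 (mnormalize returns its default argument
   when the mass is 0) *)
Definition cond_on n (S : {RV P >-> 'I_n.+1}) (s : 'I_n.+1) :
    probability Om R :=
  mnormalize (mrestr P (measurable_event_eq S s)) P.

End conditioning.

Definition eq_in_law d (T : measurableType d) (R : realType)
    (mu nu : set T -> \bar R) : Prop :=
  forall B, measurable B -> mu B = nu B.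

Section fairness.
Context d dX dV (Om : measurableType d) (TX : measurableType dX)
  (TV : measurableType dV) (R : realType) (P : probability Om R) (K : nat).
Variables (X : {RV P >-> TX}) (V : {RV P >-> TV}) (S : {RV P >-> 'I_K.+1}).
Variables (psi : TX * 'I_K.+1 -> TV) (f : TX * 'I_K.+1 -> R).

(* Law of f(X', s') given (X, S) = (x, s), where the law of the resampled
   features X' for V = v, S = s' is Q v s'. *)
Definition counterfactual_law (Q : TV -> 'I_K.+1 -> set TX -> \bar R)
    (x : TX) (s s' : 'I_K.+1) : set R -> \bar R :=
  pushforward (Q (psi (x, s)) s') (fun x' => f (x', s')).

Definition counterfactually_fair
    (Q : TV -> 'I_K.+1 -> set TX -> \bar R) : Prop :=
  forall s, {ae distribution (cond_on S s) X, forall x, forall s',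
    eq_in_law (counterfactual_law Q x s s) (counterfactual_law Q x s s')}.

Definition cond_demographic_parity
    (LY : R.-pker (TV * 'I_K.+1)%type ~> R) : Prop :=
  {ae distribution P V, forall v, forall s s',
    eq_in_law (LY (v, s)) (LY (v, s'))}.

End fairness.

(* Main.v *)
(* Write mu v s for the law of f(X', s) when X' is drawn from the resampling
   law at (v, s). Both resampling laws satisfy
   mu v s = Law(f(X, S) | V = v, S = s) for almost every v: for
   X' = phi(v, s, eps') this holds because, V being independent of S,
   conditional independence of eps and S given V makes (V, eps) independent
   of S. Conditional demographic parity thus says that, for almost every v,
   mu v s does not depend on s, and counterfactual fairness says the same at
   v = psi(x, s), for almost every x under the law of X given S = s. Given
   S = s, psi(X, s) is V, which is independent of S, so the null sets on the two
   sides correspond. Equality of two laws on R amounts to countably many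
   equalities (rational half-lines), so the set of v where it holds is
   measurable. *)
Require Import Defs.
From HB Require Import structures.
From mathcomp Require Import all_boot all_order all_algebra.
From mathcomp Require Import all_classical all_reals all_analysis.

Set Implicit Arguments.
Unset Strict Implicit.
Unset Printing Implicit Defensive.
Import Order.TTheory GRing.Theory Num.Theory.
Import measurable_realfun.
Import numFieldTopology.Exports.

Local Open Scope classical_set_scope.
Local Open Scope ring_scope.

(** A countable union of null sets is null. Indices are coded by natural numbers, and a number that
    codes no index gets the statement [True]. *)
Lemma ae_forall_countable d (T : measurableType d) (R : realType)
    (mu : {measure set T -> \bar R}) (I : countType) (Q : I -> T -> Prop) :
  (forall i, {ae mu, forall x, Q i x}) -> {ae mu, forall x, forall i, Q i x}.
Proof.
move=> aeQ; pose Q' n x := if unpickle n is Some i then Q i x else True.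
have : {ae mu, forall x n, Q' n x}.
  apply: ae_foralln => n; rewrite /Q'; case: (unpickle n) => [i|]//.
  exact: aeW.
by apply: filterS => x Q'x i; have := Q'x (pickle i); rewrite /Q' pickleK.
Qed.

(** * Laws on the real line and rational half-lines *)

Section laws_on_the_line.
Variable R : realType.

Definition rational_ray (q : rat) : set R := `]-oo, ratr q[%classic.

Lemma measurable_rational_ray q : measurable (rational_ray q).
Proof. exact: measurable_itv. Qed.

(** By density of the rationals, a ray with real endpoint [x] is the union of the rational rays with
    endpoint below [x]. *)
Lemma measurable_rational_rayE :
  (measurable : set (set R)) = <<s range rational_ray >>.
Proof.
rewrite [LHS](RGenInftyO.measurableE R) eqEsubset; split.
  apply: smallest_sub; first exact: smallest_sigma_algebra.
  move=> _ [x ->].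
  pose F q := if ratr q < x then rational_ray q else set0.
  have -> : `]-oo, x[%classic = \bigcup_q F q.
    rewrite eqEsubset; split => [y /=|y [q _]]; rewrite /F.
      rewrite in_itv/= => /rat_in_itvoo[q]; rewrite in_itv/= => /andP[yq qx].
      by exists q => //; rewrite qx /rational_ray /= in_itv.
    case: ifPn => // qx; rewrite /rational_ray /= !in_itv/= => yq.
    exact: lt_trans qx.
  suff : (range rational_ray).-sigma.-measurable (\bigcup_q F q) by [].
  apply: bigcupT_measurable_rat => q.
  rewrite /F; case: ifPn => _; last exact: measurable0.
  by apply: sub_sigma_algebra; exists q.
apply: smallest_sub; first exact: smallest_sigma_algebra.
by move=> _ [q _ <-]; apply: sub_sigma_algebra; exists (ratr q).
Qed.

(** Rational rays generate the Borel sets, are stable under intersection and exhaust the line along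
    the integers, so two measures finite on them that agree there are equal. *)
Lemma eq_in_law_rational_ray (m1 m2 : {measure set R -> \bar R}) :
  (m1 [set: R] < +oo)%E ->
  (forall q, m1 (rational_ray q) = m2 (rational_ray q)) -> eq_in_law m1 m2.
Proof.
move=> m1oo m12 B mB.
apply: (@measure_unique _ _ _ (range rational_ray)
  (fun n => rational_ray n%:R)) => //.
- exact: measurable_rational_rayE.
- move=> _ _ [p _ <-] [q _ <-]; exists (Order.min p q) => //.
  rewrite /rational_ray; apply/seteqP; split => x /=; rewrite !in_itv/=.
    case: (leP p q) => [pq|/ltW qp] xpq; split => //; apply: (lt_le_trans xpq).
      by rewrite ler_rat.
    by rewrite ler_rat.
  by move=> [xp xq]; case: (leP p q).
- rewrite -subTset => x _; exists (Num.bound x) => //.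
  rewrite /rational_ray /= in_itv/= ratr_nat.
  exact: unstable.ltr_bound.
- by move=> _ [q _ <-].
- move=> n; apply: le_lt_trans m1oo.
  by apply: le_measure; rewrite ?inE//; exact: measurable_rational_ray.
Qed.

Lemma measurable_eq_in_law d (T : measurableType d)
    (k1 k2 : T -> {measure set R -> \bar R}) :
  (forall x, (k1 x [set: R] < +oo)%E) ->
  (forall B, measurable B -> measurable_fun [set: T] (k1 ^~ B)) ->
  (forall B, measurable B -> measurable_fun [set: T] (k2 ^~ B)) ->
  measurable [set x | eq_in_law (k1 x) (k2 x)].
Proof.
move=> k1oo mk1 mk2.
rewrite (_ : mkset _ =
  \bigcap_(q : rat) [set x | k1 x (rational_ray q) = k2 x (rational_ray q)]).
  rewrite -[X in measurable X]setCK setC_bigcap; apply: measurableC.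
  apply: bigcupT_measurable_rat => q; apply: measurableC.
  rewrite -[X in measurable X]setTI.
  by apply: measurable_eqe => //; [apply: mk1|apply: mk2];
    exact: measurable_rational_ray.
apply/seteqP; split => x /= k12.
  by move=> q _; apply: k12; exact: measurable_rational_ray.
by apply: eq_in_law_rational_ray => // q; exact: k12.
Qed.

(** For a fixed ray, equal integrals over every measurable [A] give almost sure equality of the
    integrands; the bound by 1 gives integrability. The countably many exceptional null sets are
    then merged. *)
Lemma ae_eq_in_law d (T : measurableType d) (mu : probability T R)
    (k1 k2 : T -> {measure set R -> \bar R}) :
  (forall x, (k1 x [set: R] <= 1)%E) ->
  (forall B, measurable B -> measurable_fun [set: T] (k1 ^~ B)) ->
  (forall B, measurable B -> measurable_fun [set: T] (k2 ^~ B)) ->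
  (forall A B, measurable A -> measurable B ->
    (\int[mu]_(x in A) k1 x B = \int[mu]_(x in A) k2 x B)%E) ->
  {ae mu, forall x, eq_in_law (k1 x) (k2 x)}.
Proof.
move=> k1le1 mk1 mk2 k12.
have : {ae mu, forall x (q : rat),
    k1 x (rational_ray q) = k2 x (rational_ray q)}.
  apply: ae_forall_countable => q.
  have mq := measurable_rational_ray q.
  have : ae_eq mu setT (k1 ^~ (rational_ray q)) (k2 ^~ (rational_ray q)).
    apply: integral_ae_eq => //; [|exact: mk2|by move=> E _ mE; exact: k12].
    apply: (@le_integrable _ _ _ mu _ measurableT _ (cst 1%E)).
    - exact: mk1.
    - move=> x _ /=; rewrite gee0_abs// normr1; apply: le_trans (k1le1 x).
      by apply: le_measure; rewrite ?inE.
    - exact: finite_measure_integrable_cst.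
  by apply: filterS => x; exact.
apply: filterS => x k12x; apply: eq_in_law_rational_ray => //.
exact: le_lt_trans (k1le1 x) (ltry 1).
Qed.

End laws_on_the_line.

(** * Cancellation and equality up to null sets *)

Lemma muleI (R : realType) (p x y : \bar R) :
  p != 0%E -> p \is a fin_num -> (p * x = p * y)%E -> x = y.
Proof.
move=> p0 pfin pxy.
by rewrite -[x]mul1e -[y]mul1e -(mulVe p0 pfin) -!muleA pxy.
Qed.

Lemma ae_eq_measure d (T : measurableType d) (R : realType)
    (mu : {measure set T -> \bar R}) (A B : set T) :
  measurable A -> measurable B -> {ae mu, forall x, A x <-> B x} ->
  mu A = mu B.
Proof.
(* Adding the exceptional null set [N] to both sets changes neither measure and makes the sets
   equal. *)
move=> mA mB [N [mN muN ABN]].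
rewrite -(measureU0 mA mN muN) -(measureU0 mB mN muN); congr (mu _).
have {}ABN x : ~ N x -> (A x <-> B x) by move=> Nx; apply: contrapT => /ABN.
have subUN (C D : set T) :
    (forall x, ~ N x -> C x -> D x) -> C `|` N `<=` D `|` N.
  move=> CD x [Cx|]; last by right.
  by have [|Nx] := pselect (N x); [right|left; exact: CD].
by apply/seteqP; split; apply: subUN => x /ABN[].
Qed.

(** * Independence of V and S *)

Section independence.
Context d dV (Om : measurableType d) (TV : measurableType dV) (R : realType)
  (P : probability Om R) (K : nat).
Variables (V : {RV P >-> TV}) (S : {RV P >-> 'I_K.+1}).
Hypothesis VS : independent_RV P V S.
Local Open Scope ereal_scope.

Lemma integral_independent_fiber (g : TV * 'I_K.+1 -> \bar R) s A :
  measurable_fun [set: TV * 'I_K.+1] g -> (forall z, 0 <= g z) ->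
  measurable A ->
  \int[P]_(w in (fun w => (V w, S w)) @^-1` (A `*` [set s])) g (V w, S w) =
  P (S @^-1` [set s]) * \int[distribution P V]_(v in A) g (v, s).
Proof.
move=> mg g0 mA.
have mW : measurable_fun setT (fun w => (V w, S w)).
  exact: measurable_fun_pair.
pose W : {mfun Om >-> (TV * 'I_K.+1)%type} :=
  HB.pack (fun w => (V w, S w)) (isMeasurableFun.Build _ _ _ _ _ mW).
have ms : measurable_fun setT (fun v : TV => (v, s)).
  exact: measurable_fun_pair.
pose incl : {mfun TV >-> (TV * 'I_K.+1)%type} :=
  HB.pack (fun v : TV => (v, s)) (isMeasurableFun.Build _ _ _ _ _ ms).
pose r : {nonneg R} := NngNum (fine_ge0 (measure_ge0 P (S @^-1` [set s]))).
have mAs : measurable (A `*` [set s]) by exact: measurableX.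
have rE : r%:num%:E = P (S @^-1` [set s]).
  by rewrite fineK//; exact/fin_num_measure/measurable_event_eq.
transitivity (\int[pushforward P W]_(z in A `*` [set s]) g z).
  by rewrite ge0_integral_pushforward//; exact: measurable_funTS.
(* On subsets of the fibre [S = s], independence makes the law of [(V, S)] equal to [P(S = s)] times
   the image of the law of [V] under [v |-> (v, s)]. *)
rewrite (@eq_measure_integral _ _ _ _
  (pushforward (mscale r (distribution P V)) incl)); last first.
  move=> E mE EAs.
  rewrite /pushforward /= /mscale rE /distribution /pushforward.
  have -> : W @^-1` E = V @^-1` (incl @^-1` E) `&` S @^-1` [set s].
    apply/seteqP; split => w /=.
      by move=> Ew; have [_ /= Ss] := EAs _ Ew; rewrite -Ss.
    by move=> [Ew Ss]; rewrite Ss.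
  by rewrite VS; [exact: muleC|exact: measurable_funPTI|].
rewrite ge0_integral_pushforward//; last exact: measurable_funTS.
have inclA : incl @^-1` (A `*` [set s]) = A.
  by apply/seteqP; split => v //= [].
rewrite inclA ge0_integral_mscale//= ?rE//.
exact/measurable_funTS/measurableT_comp.
Qed.

End independence.

(** * Transfer between values of V and feature vectors *)

Section counterfactual_fairness.
Context d dX dV (Om : measurableType d) (TX : measurableType dX)
  (TV : measurableType dV) (R : realType) (P : probability Om R) (K : nat).
Variables (X : {RV P >-> TX}) (V : {RV P >-> TV}) (S : {RV P >-> 'I_K.+1}).
Variables (psi : {mfun (TX * 'I_K.+1)%type >-> TV}).
Variables (f : {mfun (TX * 'I_K.+1)%type >-> R}).
Variables (LY : R.-pker (TV * 'I_K.+1)%type ~> R).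
Hypothesis S_gt0 : forall s, (0 < P (S @^-1` [set s]))%E.
Hypothesis VS : independent_RV P V S.
Local Open Scope ereal_scope.

Lemma fin_num_event s : P (S @^-1` [set s]) \is a fin_num.
Proof. exact/fin_num_measure/measurable_event_eq. Qed.

Lemma cond_onE s B : cond_on S s B =
  P (B `&` S @^-1` [set s]) * (fine (P (S @^-1` [set s])))^-1%:E.
Proof.
(* The mass [P(S = s)] is positive and finite, so [mnormalize] does not return its default. *)
rewrite /cond_on /= /mnormalize /= /mrestr setTI gt_eqF ?S_gt0//=.
by have := fin_num_event s; rewrite fin_numE => /andP[_ /negPf ->].
Qed.

Lemma measurable_cond_law s s' :
  measurable [set v | eq_in_law (LY (v, s)) (LY (v, s'))].
Proof.
apply: measurable_eq_in_law => [v|B mB|B mB].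
- by rewrite prob_kernel ltry.
- exact: measurableT_comp (measurable_kernel LY B mB) _.
- exact: measurableT_comp (measurable_kernel LY B mB) _.
Qed.

Hypothesis Vpsi : {ae P, forall w, V w = psi (X w, S w)}.

Let mpsi s : measurable_fun [set: TX] (fun x => psi (x, s)).
Proof. by apply: measurableT_comp => //; exact: measurable_fun_pair. Qed.

(* Given S = s, the variable psi(X, s) is V, whose law does not depend on s. *)
Lemma distribution_cond_on_psi s N : measurable N ->
  distribution (cond_on S s) X ((fun x => psi (x, s)) @^-1` N) =
  distribution P V N.
Proof.
move=> mN; rewrite /distribution /pushforward cond_onE.
have mS := measurable_event_eq S s.
have mpN : measurable (X @^-1` ((fun x => psi (x, s)) @^-1` N)).
  apply: measurable_funPTI; rewrite -[X in measurable X]setTI; exact: mpsi.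
have mVN : measurable (V @^-1` N) by exact: measurable_funPTI.
have -> : P (X @^-1` ((fun x => psi (x, s)) @^-1` N) `&` S @^-1` [set s]) =
    P (V @^-1` N `&` S @^-1` [set s]).
  apply: ae_eq_measure; [exact: measurableI|exact: measurableI|].
  by apply: filterS Vpsi => w /= ->; split => -[/[swap] <-].
rewrite VS// -muleA -[X in _ * (X * _)]fineK ?fin_num_event// -EFinM.
by rewrite divff ?mule1// gt_eqF// fine_gt0// S_gt0/= ltey_eq fin_num_event.
Qed.

(** A measurable null cover of the exceptional set pulls back along [psi(., s)] to a null set of the
    same mass. *)
Lemma ae_psi (s : 'I_K.+1) (Q : set TV) :
  {ae distribution P V, forall v, Q v} ->
  {ae distribution (cond_on S s) X, forall x, Q (psi (x, s))}.
Proof.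
move=> [N [mN N0 QN]]; exists ((fun x => psi (x, s)) @^-1` N); split.
- by rewrite -[X in measurable X]setTI; exact: mpsi.
- by rewrite -N0; exact: distribution_cond_on_psi.
- by move=> x; exact: QN.
Qed.

(** A null set of feature vectors need not be a preimage under [psi(., s)]. Measurability of [Q]
    allows the mass of its complement to be computed directly on both sides. *)
Lemma ae_psiE (s : 'I_K.+1) (Q : set TV) : measurable Q ->
  {ae distribution (cond_on S s) X, forall x, Q (psi (x, s))} ->
  {ae distribution P V, forall v, Q v}.
Proof.
move=> mQ aeQ.
have mQC : measurable (~` Q) by exact: measurableC.
apply/negligibleP => //.
apply: etrans (esym (distribution_cond_on_psi s mQC)) _.
apply/negligibleP => //.
by rewrite -[X in measurable X]setTI; exact: mpsi.
Qed.

(** Isolates what a resampling scheme must satisfy: its output at [(v, s)] has law [LY (v, s)] for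
    almost every [v]. *)
Lemma counterfactually_fairE (Q : TV -> 'I_K.+1 -> set TX -> \bar R) :
  (forall s, {ae distribution P V, forall v,
    eq_in_law (LY (v, s)) (pushforward (Q v s) (fun x => f (x, s)))}) ->
  counterfactually_fair X S psi f Q <-> cond_demographic_parity V LY.
Proof.
move=> QLY; have aeQLY : {ae distribution P V, forall v s,
    eq_in_law (LY (v, s)) (pushforward (Q v s) (fun x => f (x, s)))}.
  exact: ae_forall_countable.
(* The identification holds at almost every [v] for all groups at once, so it can be used at
   [v = psi(x, s)] for every target group [s']. *)
have transfer s : {ae distribution (cond_on S s) X, forall x s',
    eq_in_law (LY (psi (x, s), s')) (counterfactual_law psi f Q x s s')}.
  exact: (ae_psi s aeQLY).
split => [cf|dp].
  apply: ae_forall_countable => s; apply: ae_forall_countable => s'.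
  apply: (ae_psiE (measurable_cond_law s s')).
  apply: filterS2 (transfer s) (cf s) => x LYQ QQ B mB.
  by rewrite LYQ// LYQ// (QQ s').
move=> s; apply: filterS2 (transfer s) (ae_psi s dp) => x LYQ dpx s' B mB.
by rewrite -LYQ// -LYQ// (dpx s s').
Qed.

(** Uniqueness of the conditional law on the fibre [S = s]: both kernels integrate to the same joint
    probabilities once the nonzero factor [P(S = s)] is cancelled. *)
Lemma ae_cond_law (s : 'I_K.+1) (Y : Om -> R)
    (k : TV -> {measure set R -> \bar R}) :
  is_cond_law P Y (fun w => (V w, S w)) LY ->
  (forall B, measurable B -> measurable_fun [set: TV] (k ^~ B)) ->
  (forall A B, measurable A -> measurable B ->
    P ((fun w => (V w, S w)) @^-1` (A `*` [set s]) `&` Y @^-1` B) =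
    P (S @^-1` [set s]) * \int[distribution P V]_(v in A) k v B) ->
  {ae distribution P V, forall v, eq_in_law (LY (v, s)) (k v)}.
Proof.
move=> condY mk kE; apply: ae_eq_in_law => //.
- by move=> v; rewrite prob_kernel.
- move=> B mB; exact: measurableT_comp (measurable_kernel LY B mB) _.
- move=> A B mA mB; apply: (@muleI _ (P (S @^-1` [set s]))).
  + by rewrite gt_eqF// S_gt0.
  + exact: fin_num_event.
  + rewrite -kE// condY//; last exact: measurableX.
    by rewrite (integral_independent_fiber VS s (measurable_kernel LY B mB)).
Qed.

End counterfactual_fairness.

(** * Resampled noise: joint law of V and eps, and its independence of S *)

Section resampling.
Context d dE dV (Om : measurableType d) (TE : measurableType dE)
  (TV : measurableType dV) (R : realType) (P : probability Om R) (K : nat).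
Variables (V : {RV P >-> TV}) (S : {RV P >-> 'I_K.+1}) (eps : {RV P >-> TE}).
Variable Leps : R.-pker TV ~> TE.
Local Open Scope ereal_scope.

(* No integrability is assumed, so integral_pushforward does not apply. *)
Lemma integral_preimage_RV (g : TV -> \bar R) A :
  measurable_fun [set: TV] g -> measurable A ->
  \int[P]_(w in V @^-1` A) g (V w) = \int[distribution P V]_(v in A) g v.
Proof.
move=> mg mA; rewrite integralE [RHS]integralE.
congr (_ - _).
  rewrite ge0_integral_pushforward//.
    by apply: eq_integral => w _; rewrite -funepos_comp.
  exact/measurable_funepos/measurable_funTS.
rewrite ge0_integral_pushforward//.
  by apply: eq_integral => w _; rewrite -funeneg_comp.
exact/measurable_funeneg/measurable_funTS.
Qed.

Lemma integrable_kernel B (A : set TV) : measurable B -> measurable A ->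
  (distribution P V).-integrable A (Leps ^~ B).
Proof.
move=> mB mA; apply: (@le_integrable _ _ _ _ _ mA _ (cst 1)).
- exact/measurable_funTS/measurable_kernel.
- move=> v _ /=; rewrite gee0_abs// normr1 -(prob_kernel (s := Leps) v).
  by apply: le_measure; rewrite ?inE.
- exact: finite_measure_integrable_cst.
Qed.

(** Serves to replace the unspecified versions provided by conditional independence with explicit
    ones. *)
Lemma cond_probability_unique (E : set Om) (g : TV -> R) (k : TV -> \bar R) :
  is_cond_probability P V E g ->
  (distribution P V).-integrable [set: TV] k ->
  (forall A, measurable A ->
    P (V @^-1` A `&` E) = \int[distribution P V]_(v in A) k v) ->
  {ae distribution P V, forall v, k v = (g v)%:E}.
Proof.
move=> [mg gE] ik kE.
have mgE : measurable_fun [set: TV] (EFin \o g) by exact/measurable_EFinP.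
have : ae_eq (distribution P V) setT k (EFin \o g).
  apply: integral_ae_eq => // A _ mA.
  by rewrite -kE// gE// -(integral_preimage_RV mgE mA).
by apply: filterS => v; exact.
Qed.

(** The law of [V] composed with the kernel [Leps]: the joint law of [(V, eps)] when [Leps] is the
    law of [eps] given [V]. *)
Definition semidirect (E : set (TV * TE)) : \bar R :=
  \int[distribution P V]_v Leps v (xsection E v).

Let semidirect0 : semidirect set0 = 0.
Proof. by apply: integral0_eq => v _; rewrite xsection0 measure0. Qed.

Let semidirect_ge0 E : 0 <= semidirect E.
Proof. exact: integral_ge0. Qed.

Let semidirect_sigma_additive : semi_sigma_additive semidirect.
Proof.
(* Sections of disjoint sets are disjoint, and the integral of a nonnegative series is the series of
   integrals. *)
move=> F mF tF mUF; rewrite [X in _ --> X](_ : _ =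
    \int[distribution P V]_v (\sum_(n <oo) Leps v (xsection (F n) v))).
  apply/cvg_closeP; split.
    by apply: is_cvg_nneseries => n _ _; exact: integral_ge0.
  rewrite closeE// integral_nneseries// => n.
  by apply: measurable_fun_xsection_finite_kernel; rewrite inE.
apply: eq_integral => v _; rewrite xsection_bigcup.
apply/esym/cvg_lim => //; apply: measure_semi_sigma_additive.
- by move=> n; exact: measurable_xsection.
- exact: trivIset_xsection.
- by apply: bigcupT_measurable => n; exact: measurable_xsection.
Qed.

HB.instance Definition _ := isMeasure.Build _ _ _ semidirect
  semidirect0 semidirect_ge0 semidirect_sigma_additive.

Lemma semidirectX A B : measurable A -> measurable B ->
  semidirect (A `*` B) = \int[distribution P V]_(v in A) Leps v B.
Proof.
move=> mA mB; rewrite [RHS]integral_mkcond; apply: eq_integral => v _.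
rewrite patchE; case: ifPn => vA; first by rewrite in_xsectionX.
by rewrite notin_xsectionX// measure0.
Qed.

Hypothesis VS : independent_RV P V S.
Hypothesis epsS : cond_independent_RV P eps S V.
Hypothesis epsV : is_cond_law P eps V Leps.

(** Conditional independence gives the integrand [g * h], where [g] is [Leps v B] almost surely and
    [h] is the constant [P(S = s)], since [V] is independent of [S]. *)
Lemma probability_rectangle_fiber s A B : measurable A -> measurable B ->
  P (V @^-1` A `&` (eps @^-1` B `&` S @^-1` [set s])) =
  P (S @^-1` [set s]) * semidirect (A `*` B).
Proof.
move=> mA mB; have mLB := measurable_kernel Leps B mB.
have [] := epsS mB (_ : measurable [set s]) => // g [h [cg ch [mgh ghE]]].
have Pfin : P (S @^-1` [set s]) \is a fin_num.
  exact/fin_num_measure/measurable_event_eq.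
have gL : {ae distribution P V, forall v, Leps v B = (g v)%:E}.
  apply: (cond_probability_unique cg); first exact: integrable_kernel.
  by move=> C mC; rewrite epsV// (integral_preimage_RV mLB mC).
have hS : {ae distribution P V, forall v, P (S @^-1` [set s]) = (h v)%:E}.
  apply: (cond_probability_unique ch).
    rewrite -(fineK Pfin); exact: finite_measure_integrable_cst.
  move=> C mC; rewrite VS// -[in RHS](fineK Pfin) integral_cst// fineK//.
  by rewrite muleC.
rewrite ghE// semidirectX//.
have mghE : measurable_fun [set: TV] (fun v => (g v * h v)%:E).
  exact/measurable_EFinP.
rewrite (integral_preimage_RV mghE mA) -ge0_integralZl//; last first.
  exact: measurable_funTS.
apply: ae_eq_integral => //.
- exact: measurable_funTS.
- by apply: measurable_funTS; exact: emeasurable_funM.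
- by apply: filterS2 gL hS => v -> -> _; rewrite -EFinM mulrC.
Qed.

(** Measurable rectangles generate the product sigma-algebra and are stable under intersection, so
    the rectangle identity extends to all events. *)
Lemma probability_joint_fiber s E : measurable E ->
  P ((fun w => (V w, eps w)) @^-1` E `&` S @^-1` [set s]) =
  P (S @^-1` [set s]) * semidirect E.
Proof.
move=> mE; have mJ : measurable_fun setT (fun w => (V w, eps w)).
  exact: measurable_fun_pair.
pose J : {mfun Om >-> (TV * TE)%type} :=
  HB.pack (fun w => (V w, eps w)) (isMeasurableFun.Build _ _ _ _ _ mJ).
pose r : {nonneg R} := NngNum (fine_ge0 (measure_ge0 P (S @^-1` [set s]))).
have rE : r%:num%:E = P (S @^-1` [set s]).
  by rewrite fineK//; exact/fin_num_measure/measurable_event_eq.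
rewrite -rE.
(* The two sides as measures in [E]; [m1] is finite, so the whole space serves as the exhausting
   sequence. *)
pose m1 := pushforward (mrestr P (measurable_event_eq S s)) J.
pose m2 := mscale r semidirect.
apply: (@measure_unique _ _ _
  [set A `*` B | A in measurable & B in measurable] (fun=> setT) _ _ _ _
  m1 m2) => //.
- by rewrite measurable_prod_measurableType.
- move=> _ _ [A mA [B mB <-]] [A' mA' [B' mB' <-]].
  exists (A `&` A'); first exact: measurableI.
  by exists (B `&` B'); [exact: measurableI|rewrite setXI].
- by move=> _; exists setT => //; exists setT => //; rewrite setXTT.
- by rewrite -subTset => x _; exists 0%N.
- move=> _ [A mA [B mB <-]].
  transitivity (P (V @^-1` A `&` (eps @^-1` B `&` S @^-1` [set s]))).
    by rewrite setIA.
  by rewrite probability_rectangle_fiber// -rE.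
- move=> _; apply: (@le_lt_trans _ _ (P [set: Om])); last first.
    by rewrite probability_setT ltry.
  apply: le_measure; rewrite ?inE//.
  apply: measurableI; first exact: (measurable_funPTI J).
  exact: measurable_event_eq.
Qed.

End resampling.

(** * The equivalence for both resampling schemes *)

Theorem proposition1 (R : realType) (dO dE : measure_display)
  (Om : measurableType dO) (TE : measurableType dE)
  (P : probability Om R) (d K : nat)
  (calX : set (d.-tuple R)) (mcalX : measurable calX) (x0 : calX)
  (X : {RV P >-> msubspace x0}) (V : {RV P >-> unit_interval R})
  (S : {RV P >-> 'I_K.+1}) (eps : {RV P >-> TE})
  (phi : {mfun (unit_interval R * 'I_K.+1 * TE)%type >-> msubspace x0})
  (psi : {mfun (msubspace x0 * 'I_K.+1)%type >-> unit_interval R})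
  (f : {mfun (msubspace x0 * 'I_K.+1)%type >-> R})
  (LX : R.-pker (unit_interval R * 'I_K.+1)%type ~> msubspace x0)
  (LY : R.-pker (unit_interval R * 'I_K.+1)%type ~> R) :
  (forall s, (0 < P (S @^-1` [set s]))%E) ->
  (forall A : set R, measurable A ->
     P ((fun w => unit_val (V w)) @^-1` A) = uniform_prob (@ltr01 R) A) ->
  independent_RV P V S ->
  (forall w, X w = phi (V w, S w, eps w)) ->
  cond_independent_RV P eps S V ->
  {ae P, forall w, V w = psi (X w, S w)} ->
  is_cond_law P X (fun w => (V w, S w)) LX ->
  is_cond_law P (fun w => f (X w, S w)) (fun w => (V w, S w)) LY ->
  (* X' drawn from Law(X | V = v, S = s') *)
  (counterfactually_fair X S psi f (fun v s' => LX (v, s')) <->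
   cond_demographic_parity V LY) /\
  (* X' = phi(v, s', eps') with eps' drawn from Law(eps | V = v) *)
  (forall Leps : R.-pker (unit_interval R) ~> TE, is_cond_law P eps V Leps ->
    (counterfactually_fair X S psi f
       (fun v s' => pushforward (Leps v) (fun e => phi (v, s', e))) <->
     cond_demographic_parity V LY)).
Proof.
move=> S_gt0 _ VS Xphi epsS Vpsi condX condY.
have mf s : measurable_fun setT (fun x => f (x, s)).
  by apply: measurableT_comp => //; exact: measurable_fun_pair.
pose f_ s : {mfun (msubspace x0) >-> R} :=
  HB.pack (fun x => f (x, s)) (isMeasurableFun.Build _ _ _ _ _ (mf s)).
split=> [|Leps epsV].
  apply: counterfactually_fairE => // s.
  apply: (ae_cond_law S_gt0 VS
    (k := fun v => pushforward (LX (v, s)) (f_ s)) condY).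
    move=> B mB; have mfB : measurable (f_ s @^-1` B).
      exact: measurable_funPTI.
    exact: measurableT_comp (measurable_kernel LX _ mfB) _.
  move=> A B mA mB; have mfB : measurable (f_ s @^-1` B).
    exact: measurable_funPTI.
  rewrite -(integral_independent_fiber VS s (measurable_kernel LX _ mfB))//.
  rewrite -condX//; last exact: measurableX.
  congr (P _); apply/seteqP; split => w /= [[Aw Ss] Bw].
    by rewrite -Ss.
  by split => //; rewrite Ss.
apply: counterfactually_fairE => // s.
have mphi v : measurable_fun setT (fun e => f_ s (phi (v, s, e))).
  by do 2 apply: measurableT_comp => //.
pose g v : {mfun TE >-> R} :=
  HB.pack (fun e => f_ s (phi (v, s, e)))
    (isMeasurableFun.Build _ _ _ _ _ (mphi v)).
(* Encoding the output event as a set of pairs [(v, e)] makes the output law at [v] the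
   [Leps v]-mass of a section, hence measurable in [v]. *)
pose D B := [set ve : unit_interval R * TE | B (f_ s (phi (ve.1, s, ve.2)))].
have mD B : measurable B -> measurable (D B).
  move=> mB; rewrite -[D B]setTI.
  apply: (_ : measurable_fun setT (fun ve => f_ s (phi (ve.1, s, ve.2)))) => //.
  do 2 apply: measurableT_comp => //.
  by do 2 apply: measurable_fun_pair => //.
have DE B v : pushforward (Leps v) (g v) B = Leps v (xsection (D B) v).
  by rewrite xsectionE.
apply: (ae_cond_law S_gt0 VS (k := fun v => pushforward (Leps v) (g v)) condY).
  move=> B mB.
  apply: (eq_measurable_fun (fun v => Leps v (xsection (D B) v))) => [v _|].
    by rewrite -DE.
  by apply: measurable_fun_xsection_finite_kernel; rewrite inE; exact: mD.
move=> A B mA mB.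
have mADB : measurable ((A `*` setT) `&` D B).
  by apply: measurableI; [exact: measurableX|exact: mD].
(* On [S = s] the features are [phi(V, s, eps)], so the event depends on [(V, eps)] alone. *)
transitivity (P ((fun w => (V w, eps w)) @^-1` ((A `*` setT) `&` D B) `&`
    S @^-1` [set s])).
  congr (P _); apply/seteqP; split => w /=; rewrite /D/= Xphi.
    by move=> [[Aw <-] Bw].
  by move=> [[[Aw _] Bw] Ss]; rewrite Ss.
rewrite (probability_joint_fiber VS epsS epsV s mADB); congr (_ * _)%E.
(* Outside [A] the section is empty, which restricts the integral to [A]. *)
rewrite /semidirect [RHS]integral_mkcond; apply: eq_integral => v _.
rewrite patchE xsectionI; case: ifPn => vA.
  by rewrite in_xsectionX// setTI -DE.
by rewrite notin_xsectionX// set0I measure0.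
Qed.
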